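(* Let $K_4-e$ be the graph obtained from the complete graph $K_4$ by removing one edge. The set of all ordered multiplicity lists attained by matrices in $\mathcal{S}_L(K_4-e)$ is exactly $\{(1,1,1,1), (1,1,2), (1,2,1)\}$.
   Context: For a finite simple graph $G$ on $n$ vertices, $\mathcal{S}_L(G)$ denotes the set of $n\times n$ real symmetric matrices $A=[a_{i,j}]$ such that $a_{i,j}<0$ if $\{i,j\}\in E(G)$, $a_{i,j}=0$ if $i\neq j$ and $\{i,j\}\notin E(G)$, and $a_{i,i}=-\sum_{k\neq i}a_{i,k}$ for all $i$. The ordered multiplicity list of $A\in\mathcal{S}_L(G)$ is $(m_1,\ldots,m_q)$, where $\lambda_1<\lambda_2<\cdots<\lambda_q$ are the distinct eigenvalues of $A$ in increasing order and $m_i$ is the multiplicity of $\lambda_i$. *)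

(* Defs.v *)
From HB Require Import structures.
From mathcomp Require Import all_boot all_order all_algebra.
From mathcomp Require Import classical_sets reals.

Set Implicit Arguments.
Unset Strict Implicit.
Unset Printing Implicit Defensive.

Import Order.TTheory GRing.Theory Num.Theory.

Local Open Scope ring_scope.
Local Open Scope classical_set_scope.

Record sgraph (n : nat) := SGraph {
  adj : rel 'I_n;
  adj_sym : symmetric adj;
  adj_irr : irreflexive adj }.

Definition complete_rel (n : nat) : rel 'I_n := fun i j => i != j.

Lemma complete_sym n : symmetric (@complete_rel n).
Proof. by move=> i j; rewrite /complete_rel eq_sym. Qed.

Lemma complete_irr n : irreflexive (@complete_rel n).
Proof. by move=> i; rewrite /complete_rel eqxx. Qed.

Definition complete_graph (n : nat) : sgraph n :=
  SGraph (@complete_sym n) (@complete_irr n).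

Definition del_edge_rel (n : nat) (G : sgraph n) (u v : 'I_n) : rel 'I_n :=
  fun i j => adj G i j && ~~ ((i == u) && (j == v) || (i == v) && (j == u)).

Lemma del_edge_sym n (G : sgraph n) u v : symmetric (del_edge_rel G u v).
Proof.
move=> i j; rewrite /del_edge_rel adj_sym; congr (_ && ~~ _).
by rewrite orbC andbC [(i == u) && _]andbC.
Qed.

Lemma del_edge_irr n (G : sgraph n) u v : irreflexive (del_edge_rel G u v).
Proof. by move=> i; rewrite /del_edge_rel adj_irr. Qed.

Definition del_edge (n : nat) (G : sgraph n) (u v : 'I_n) : sgraph n :=
  SGraph (del_edge_sym G u v) (del_edge_irr G u v).

(* Vertices 0, 1, 2, 3; all choices of the deleted edge are isomorphic, and
   here it is {0, 3}. *)
Definition K4_minus_e : sgraph 4 := del_edge (complete_graph 4) ord0 ord_max.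

Definition SL (R : realType) (n : nat) (G : sgraph n) : set 'M[R]_n :=
  [set A | [/\ A^T = A,
               forall i j, adj G i j -> A i j < 0,
               forall i j, i != j -> ~~ adj G i j -> A i j = 0 &
               forall i, A i i = - \sum_(k < n | k != i) A i k]].

(* The witness s is unique: it lists the distinct eigenvalues in increasing
   order.  The multiplicity is the algebraic one, which for the symmetric
   matrices in SL equals the dimension of the eigenspace. *)
Definition is_ordered_mult_list (R : realType) (n : nat) (A : 'M[R]_n)
    (m : seq nat) : Prop :=
  exists s : seq R,
    [/\ sorted <%R s,
        forall a : R, (a \in s) = eigenvalue A a &
        m = [seq mup a (char_poly A) | a <- s]].

Definition ordered_mult_lists (R : realType) (n : nat) (G : sgraph n) :
    set (seq nat) :=
  [set m | exists2 A : 'M[R]_n, SL G A & is_ordered_mult_list A m].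

(* Main.v *)
Require Import Defs.
From mathcomp Require Import all_boot all_order all_algebra.
From mathcomp Require Import classical_sets reals.
From mathcomp Require Import complex spectral ring zify.

(** Let [A] be in [SL K4_minus_e].  It is real symmetric, hence diagonalizable
    over the reals, and the algebraic multiplicity of each eigenvalue is the
    dimension of its eigenspace ([real_spectral]).  In particular the entries
    of the multiplicity list add up to 4 ([real_sym_sumn]).  The quadratic form
    of [A] is the Dirichlet form of the edge weights [- A i j]
    ([SL_dirichlet]), a sum of nonnegative terms: so all eigenvalues are
    nonnegative, and since the graph is connected the kernel consists of the
    constant vectors.  The list therefore starts with the simple eigenvalue 0
    ([SL_connected_mult_list]), and what follows is a composition of 3.

    Of the four compositions of 3 only (3) is impossible: a triple eigenvalue
    [a] would make [A - a] a matrix of rank one, all of whose two-by-two minors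
    vanish.  The minor on rows 0, 1 and columns 2, 3 avoids the diagonal, and
    it equals [A 0 2 * A 1 3], because the missing edge forces [A 0 3 = 0]; but
    the edges 02 and 13 are present ([K4_minus_e_mup_neq3]).

    The other three lists are attained by matrices that are invariant under the
    exchange of the vertices 0 and 3.  Giving weight [a] to the edges at 1,
    weight [b] to those at 2, and weight [c] to the edge 12, the vector
    (1, 0, 0, -1) has eigenvalue [a + b].  For [a = b = 1] the nonzero
    eigenvalues are 2, 4 and [2 + 2 c], which gives (1,1,2) for [c = 1] and
    (1,1,1,1) for [c = 2].  For (1,2,1) the smallest nonzero eigenvalue has to
    be double; [a + b] is a double eigenvalue exactly when
    [c (a + b) = (a - b)^2], and then the remaining one is [2 (a + b) + 2 c].
    The solution [a = 1], [b = 3], [c = 1] has spectrum 0, 4, 4, 10. *)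

Local Open Scope classical_set_scope.

Section Auxiliary.

Set Implicit Arguments.
Unset Strict Implicit.
Import Order.TTheory GRing.Theory Num.Theory.
Local Open Scope ring_scope.

(** * Spectra of diagonalizable and of real symmetric matrices *)

Lemma mxrank_diag (F : fieldType) n (d : 'rV[F]_n) :
  \rank (diag_mx d) = (\sum_i (d 0%R i != 0%R))%N.
Proof.
elim: n d => [|n IHn] d; first by rewrite big_ord0 [diag_mx d]flatmx0 mxrank0.
have [u [v dE]] : exists (u : 'rV[F]_1) (v : 'rV[F]_n), d = row_mx u v.
  by exists (lsubmx (d : 'rV_(1 + n))), (rsubmx (d : 'rV_(1 + n))); rewrite hsubmxK.
have -> : \rank (diag_mx d) = (\rank (diag_mx u) + \rank (diag_mx v))%N.
  by rewrite dE -rank_diag_block_mx -diag_mx_row.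
rewrite IHn dE.
rewrite big_ord_recl; congr (_ + _)%N; last first.
  apply: eq_bigr => i _; rewrite -(row_mxEr u v).
  by congr ((_ != _) : nat); congr (row_mx _ _ _ _); apply/val_inj.
have -> : row_mx u v 0 (ord0 : 'I_n.+1) = u 0 0.
  by rewrite -(row_mxEl u v); congr (row_mx _ _ _ _); apply/val_inj.
have -> : diag_mx u = u by apply/rowP => i; rewrite !mxE !ord1.
rewrite rank_rV; congr (nat_of_bool (~~ _)).
apply/eqP/eqP => [->|u0]; first by rewrite mxE.
by apply/rowP => i; rewrite ord1 u0 mxE.
Qed.

Lemma char_poly_similar (F : fieldType) n (P A B : 'M[F]_n) :
  P \in unitmx -> P *m A = B *m P -> char_poly A = char_poly B.
Proof.
rewrite unitmxE unitfE => P_unit PA.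
set Q := map_mx polyC P.
have QA : Q *m char_poly_mx A = char_poly_mx B *m Q.
  rewrite /char_poly_mx mulmxBr mulmxBl -!map_mxM PA; congr (_ - _).
  by rewrite scalar_mxC.
have detQ : \det Q != 0 by rewrite det_map_mx polyC_eq0.
apply: (mulfI detQ); rewrite -[RHS]mulrC /char_poly -!det_mulmx.
by rewrite QA.
Qed.

Lemma char_poly_diag (F : fieldType) n (P A : 'M[F]_n) (d : 'rV[F]_n) :
    P \in unitmx -> P *m A = diag_mx d *m P ->
  char_poly A = \prod_i ('X - (d 0 i)%:P).
Proof.
move=> P_unit PA; rewrite (char_poly_similar P_unit PA) char_poly_trig.
  by apply: eq_bigr => i _; rewrite mxE eqxx mulr1n.
exact/is_diag_mx_is_trig/diag_mx_is_diag.
Qed.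

Lemma mxrank_eigenspace_diag (F : fieldType) n (P A : 'M[F]_n) (d : 'rV[F]_n) a :
    P \in unitmx -> P *m A = diag_mx d *m P ->
  \rank (eigenspace A a) = (\sum_i (d 0%R i == a))%N.
Proof.
move=> P_unit PA; rewrite mxrank_ker.
have -> : \rank (A - a%:M) = (\sum_i (d 0%R i != a))%N.
  have PAa : P *m (A - a%:M) = diag_mx (d - const_mx a) *m P.
    by rewrite mulmxBr PA raddfB /= diag_const_mx mulmxBl scalar_mxC.
  have /eqmxMfull E : row_full P by rewrite row_full_unit.
  rewrite -(E _ (A - a%:M)) PAa mxrankMfree ?row_free_unit // mxrank_diag.
  by apply: eq_bigr => i _; rewrite !mxE subr_eq0.
rewrite -[n in (n - _)%N]card_ord -sum1_card.
rewrite [X in (X - _)%N](eq_bigr (fun i => (d 0%R i == a) + (d 0%R i != a))%N).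
  by rewrite big_split /= addnK.
by move=> i _; case: eqP.
Qed.

Lemma mup_prod_XsubC (F : fieldType) n (d : 'rV[F]_n) a :
  mup a (\prod_i ('X - (d 0 i)%:P)) = (\sum_i (d 0%R i == a))%N.
Proof.
rewrite -(big_map (fun i => d 0 i) predT (fun x => 'X - x%:P)) mu_prod_XsubC.
by rewrite count_map -sum1_count big_mkcond /=.
Qed.

(** Over the algebraic closure [R[i]] a Hermitian matrix is diagonalizable with
    eigenvalues in [R].  Neither the characteristic polynomial nor the rank of
    [A - a] changes when the field is extended, so both conclusions descend to
    [R] without having to build an eigenbasis over it. *)
Lemma real_spectral (R : rcfType) n (A : 'M[R]_n) : A^T = A ->
  exists d : 'rV[R]_n,
    char_poly A = \prod_i ('X - (d 0 i)%:P) /\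
    forall a, \rank (eigenspace A a) = mup a (char_poly A).
Proof.
move=> symA; pose f : {rmorphism R -> R[i]} := real_complex R.
have Aherm : map_mx f A \is hermsymmx.
  apply: realsym_hermsym.
    by apply/is_hermitianmxP; rewrite expr0 scale1r map_mx_id // map_trmx symA.
  by apply/mxOverP => i j; rewrite mxE complex_real.
have /orthomx_spectralP Adiag := hermitian_normalmx Aherm.
have dreal := hermitian_spectral_diag_real Aherm.
move: (spectral_unit (map_mx f A)) Adiag dreal.
move: (spectralmx _) (spectral_diag _) => P sp P_unit Adiag dreal.
pose d := map_mx (@complex.Re R) sp.
have spE : sp = map_mx f d.
  apply/rowP => i; rewrite !mxE; symmetry; apply: RRe_real.
  exact: (mxOverP dreal).
have PA : P *m map_mx f A = diag_mx sp *m P.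
  by rewrite {1}Adiag !mulmxA mulmxV // mul1mx.
have cpA : char_poly A = \prod_i ('X - (d 0 i)%:P).
  apply: (map_poly_inj f).
  rewrite map_char_poly (char_poly_diag P_unit PA) rmorph_prod.
  by apply: eq_bigr => i _; rewrite rmorphB /= map_polyX map_polyC spE !mxE.
exists d; split=> // a.
rewrite cpA mup_prod_XsubC -(mxrank_map f) map_eigenspace.
rewrite (mxrank_eigenspace_diag _ P_unit PA).
by apply: eq_bigr => i _; rewrite spE mxE (inj_eq (fmorph_inj f)).
Qed.

(** * Weighted Laplacians *)

Section Laplacian.

Variables (R : realType) (n : nat) (G : sgraph n) (A : 'M[R]_n).
Hypothesis AG : SL G A.

Lemma SL_row_sum i : \sum_j A i j = 0.
Proof.
by case: AG => _ _ _ Adiag; rewrite (bigD1 i) //= Adiag addrC subrr.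
Qed.

(** Expanding the square on the right gives, up to sign, the two sums of
    [A i j * v 0 i ^+ 2] and [A i j * v 0 j ^+ 2], which vanish because rows and
    columns add up to zero; the cross terms give the left side. *)
Lemma SL_dirichlet (v : 'rV[R]_n) :
  2 * \sum_i (v *m A) 0 i * v 0 i = \sum_i \sum_j - A i j * (v 0 i - v 0 j) ^+ 2.
Proof.
have [symA _ _ _] := AG.
have AC i j : A i j = A j i by rewrite -{1}symA mxE.
pose Si := \sum_i \sum_j A i j * v 0 i ^+ 2.
pose Sj := \sum_i \sum_j A i j * v 0 j ^+ 2.
have Si0 : Si = 0.
  by apply: big1 => i _; rewrite -mulr_suml SL_row_sum mul0r.
have Sj0 : Sj = 0.
  rewrite /Sj exchange_big -[RHS]Si0; apply: eq_bigr => i _; apply: eq_bigr => j _.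
  by rewrite AC.
(* The zero subtracted from the left side is written as [Si + Sj]. *)
rewrite -[LHS]subr0 -[X in _ - X]addr0 -[X in _ - (X + _)]Si0.
rewrite -[X in _ - (_ + X)]Sj0 mulr_sumr -big_split /= -sumrB.
apply: eq_bigr => i _; rewrite mxE mulr_suml mulr_sumr -big_split -sumrB /=.
by apply: eq_bigr => j _; rewrite (AC j i); ring.
Qed.

Lemma SL_dirichlet_ge0 (v : 'rV[R]_n) i j : 0 <= - A i j * (v 0 i - v 0 j) ^+ 2.
Proof.
have [_ Aneg A0 _] := AG.
have [->|ij] := eqVneq i j; first by rewrite subrr expr0n mulr0.
apply: mulr_ge0; last exact: sqr_ge0.
by rewrite oppr_ge0; case: (boolP (adj G i j)) => [/Aneg/ltW|/(A0 i j ij)->].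
Qed.

Lemma SL_eigenvalue_ge0 a : eigenvalue A a -> 0 <= a.
Proof.
case/eigenvalueP => v vA v0; rewrite leNgt; apply/negP => a_lt0.
have := SL_dirichlet v.
have -> : \sum_i (v *m A) 0 i * v 0 i = a * \sum_i v 0 i ^+ 2.
  by rewrite vA mulr_sumr; apply: eq_bigr => i _; rewrite mxE; ring.
have D0 : 0 <= \sum_i \sum_j - A i j * (v 0 i - v 0 j) ^+ 2.
  by apply: sumr_ge0 => i _; apply: sumr_ge0 => j _; apply: SL_dirichlet_ge0.
have N0 : 0 < \sum_i v 0 i ^+ 2.
  have [i vi] : exists i, v 0 i != 0 by apply/rV0Pn.
  rewrite (bigD1 i) //= ltr_pwDl ?exprn_even_gt0 //.
  by apply: sumr_ge0 => j _; apply: sqr_ge0.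
by move=> E; move: D0; rewrite -E leNgt pmulr_rlt0 ?ltr0n // nmulr_rlt0 ?N0.
Qed.

(** For [v] in the kernel the Dirichlet form is zero, hence so is each of its
    nonnegative terms; on an edge the weight can be cancelled. *)
Lemma SL_ker_adj (v : 'rV[R]_n) i j : v *m A = 0 -> adj G i j -> v 0 i = v 0 j.
Proof.
move=> vA ij; have [_ Aneg _ _] := AG.
have := SL_dirichlet v; rewrite vA.
rewrite [X in 2 * X]big1 => [|k _]; last by rewrite mxE mul0r.
move=> /esym/eqP; rewrite mulr0.
rewrite psumr_eq0; last first.
  by move=> k _; apply: sumr_ge0 => l _; apply: SL_dirichlet_ge0.
move=> /allP/(_ i (mem_index_enum i)) /=.
rewrite psumr_eq0; last by move=> l _; apply: SL_dirichlet_ge0.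
move=> /allP/(_ j (mem_index_enum j)) /=.
by rewrite mulf_eq0 oppr_eq0 lt_eqF ?Aneg //= sqrf_eq0 subr_eq0 => /eqP.
Qed.

End Laplacian.

(** The kernel is spanned by the constant vector: a vector of the kernel takes
    equal values along each edge, hence along each path. *)
Lemma SL_connected_nullity (R : realType) n (G : sgraph n.+1) (A : 'M[R]_n.+1) :
    SL G A -> (forall i j, connect (adj G) i j) ->
  \rank (eigenspace A 0) = 1%N.
Proof.
move=> AG conn; pose u : 'rV[R]_n.+1 := const_mx 1.
have rku : \rank u = 1%N.
  rewrite rank_rV; case: eqP => // /rowP/(_ ord0)/eqP.
  by rewrite !mxE oner_eq0.
apply/eqP; rewrite eqn_leq -{1}rku -{2}rku; apply/andP; split; apply: mxrankS.
  apply/rV_subP => v /eigenspaceP; rewrite scale0r => vA.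
  have vE i : v 0 i = v 0 0.
    case/connectP: (conn i 0) => p ip ->.
    elim: p i ip => //= j p IHp i /andP[ij jp].
    by rewrite (SL_ker_adj AG vA ij) IHp.
  by apply/sub_rVP; exists (v 0 0); apply/rowP => i; rewrite !mxE mulr1 vE.
apply/eigenspaceP; rewrite scale0r; apply/rowP => j; rewrite !mxE.
have [symA _ _ _] := AG.
rewrite -[RHS](SL_row_sum AG j); apply: eq_bigr => i _.
by rewrite mxE mul1r -{1}symA mxE.
Qed.

(** A matrix of rank one is the product of a column and a row. *)
Lemma mxrank1_minor (F : fieldType) m n (M : 'M[F]_(m, n)) i j k l :
  \rank M = 1%N -> M i k * M j l = M i l * M j k.
Proof.
move=> rkM; rewrite -(mulmx_base M); move: (col_base M) (row_base M).
by rewrite rkM => u v; rewrite !mxE !big_ord1; ring.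
Qed.

Lemma K4_minus_e_connected i j : connect (adj K4_minus_e) i j.
Proof.
(* Vertex 1 is adjacent to every other vertex. *)
have to1 k : connect (adj K4_minus_e) k (inord 1).
  have [->|k1] := eqVneq k (inord 1); first exact: connect0.
  apply/connect1; rewrite /= /del_edge_rel /= /complete_rel k1.
  by rewrite -!val_eqE /= inordK //= !andbF.
apply: (connect_trans (to1 i)).
by rewrite (sym_connect_sym (@adj_sym _ _)).
Qed.

(** * Constraints on multiplicity lists *)

Lemma sumn_count_mem (T : eqType) (s t : seq T) : uniq s -> s =i t ->
  sumn [seq count_mem x t | x <- s] = size t.
Proof.
move=> s_uniq st; rewrite -[RHS](perm_size (perm_count_undup t)) size_flatten.
have s_t : perm_eq s (undup t).
  by apply: uniq_perm => // [|x]; rewrite ?undup_uniq // mem_undup st.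
rewrite (perm_sumn (perm_map _ s_t)) /shape -map_comp; congr sumn.
by apply: eq_map => x /=; rewrite size_nseq.
Qed.

Lemma real_sym_sumn (R : realType) n (A : 'M[R]_n) m :
  A^T = A -> is_ordered_mult_list A m -> sumn m = n.
Proof.
move=> /real_spectral[d [cpA _]] [s [s_sorted sE ->]].
have s_uniq : uniq s by apply: sorted_uniq s_sorted; [exact: lt_trans | exact: ltxx].
pose t := [seq d 0 i | i : 'I_n].
have cpt : char_poly A = \prod_(x <- t) ('X - x%:P) by rewrite cpA big_image.
transitivity (size t); last by rewrite size_image card_ord.
rewrite -(sumn_count_mem s_uniq) => [|a].
  by congr sumn; apply: eq_map => a; rewrite cpt mu_prod_XsubC.
by rewrite sE eigenvalue_root_char cpt root_prod_XsubC.
Qed.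

Lemma SL_connected_mult_list (R : realType) n (G : sgraph n.+1) (A : 'M[R]_n.+1) m :
    SL G A -> (forall i j, connect (adj G) i j) -> is_ordered_mult_list A m ->
  exists s, [/\ all (fun a => 0 < mup a (char_poly A))%N s
               & m = 1%N :: [seq mup a (char_poly A) | a <- s]].
Proof.
move=> AG conn [s [s_sorted sE ->]]; have [symA _ _ _] := AG.
have [d [cpA rkA]] := real_spectral symA.
have mup0 : mup 0 (char_poly A) = 1%N by rewrite -rkA (SL_connected_nullity AG).
have eigE a : eigenvalue A a = (0 < mup a (char_poly A))%N.
  by rewrite /eigenvalue -mxrank_eq0 rkA lt0n.
case: s s_sorted sE => [|b s] s_sorted sE; first by move: (sE 0); rewrite eigE mup0.
have b0 : b = 0.
  have b_ge0 : 0 <= b by apply: (SL_eigenvalue_ge0 AG); rewrite -sE mem_head.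
  have := sE 0; rewrite eigE mup0 /= inE => /orP[/eqP //|s0].
  have /allP/(_ 0 s0) := order_path_min lt_trans s_sorted.
  by rewrite ltNge b_ge0.
exists s; split; last by rewrite /= b0 mup0.
by apply/allP => a sa; rewrite -eigE -sE inE sa orbT.
Qed.

Lemma K4_minus_e_mup_neq3 (R : realType) (A : 'M[R]_4) a :
  SL K4_minus_e A -> mup a (char_poly A) <> 3%N.
Proof.
move=> AG; have [symA Aneg A0 _] := AG; have [d [_ rkA]] := real_spectral symA.
pose v k : 'I_4 := inord k.
rewrite -rkA mxrank_ker => rk3.
have rk1 : \rank (A - a%:M) = 1%N.
  by rewrite -[LHS](subKn (rank_leq_row _)) rk3.
have vE k l : (k < 4)%N -> (l < 4)%N -> (v k == v l) = (k == l).
  by move=> k4 l4; rewrite -val_eqE /= !inordK.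
have v0 : (ord0 : 'I_4) = v 0%N by apply/val_inj; rewrite /= inordK.
have v3 : (ord_max : 'I_4) = v 3%N by apply/val_inj; rewrite /= inordK.
have A02 : A (v 0%N) (v 2%N) < 0.
  by apply: Aneg; rewrite /= /del_edge_rel /= /complete_rel v0 v3 !vE.
have A13 : A (v 1%N) (v 3%N) < 0.
  by apply: Aneg; rewrite /= /del_edge_rel /= /complete_rel v0 v3 !vE.
have A03 : A (v 0%N) (v 3%N) = 0.
  by apply: A0; rewrite /= /del_edge_rel /= /complete_rel ?v0 ?v3 !vE.
have := mxrank1_minor (v 0%N) (v 1%N) (v 2%N) (v 3%N) rk1.
rewrite !mxE !vE // !subr0 A03 mul0r => /eqP.
by rewrite mulf_eq0 !lt_eqF.
Qed.

Lemma compositions_of_3 (m : seq nat) :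
    sumn m = 3%N -> all (fun k => 0 < k)%N m ->
  m = [:: 1; 1; 1]%N \/ m = [:: 1; 2]%N \/ m = [:: 2; 1]%N \/ m = [:: 3%N].
Proof.
case: m => [|a [|b [|c [|d m]]]] //=.
- by rewrite addn0 => ->; do 3 right.
- move=> sum3 /and3P[a0 b0 _]; right.
  have [[-> ->]|[-> ->]] : (a = 1 /\ b = 2 \/ a = 2 /\ b = 1)%N by lia.
    by left.
  by right; left.
- move=> sum3 /and4P[a0 b0 c0 _]; left.
  by have [-> [-> ->]] : (a = 1 /\ b = 1 /\ c = 1)%N by lia.
- by move=> sum3 /and5P[a0 b0 c0 d0 _]; exfalso; lia.
Qed.

Lemma mult_list_K4_minus_e (R : realType) (A : 'M[R]_4) m :
    SL K4_minus_e A -> is_ordered_mult_list A m ->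
  m = [:: 1; 1; 1; 1]%N \/ m = [:: 1; 1; 2]%N \/ m = [:: 1; 2; 1]%N.
Proof.
move=> AG mA; have [symA _ _ _] := AG.
have sum_m := real_sym_sumn symA mA.
have [s [s_gt0 mE]] := SL_connected_mult_list AG K4_minus_e_connected mA.
have s_neq3 : [seq mup a (char_poly A) | a <- s] <> [:: 3%N].
  by case: s {s_gt0 mE} => [|a [|b s]] //= [/(K4_minus_e_mup_neq3 AG)].
move: s_gt0; rewrite -(all_map _ (fun k => 0 < k)%N).
move: sum_m; rewrite mE /= => -[sum3] /(compositions_of_3 sum3).
by case=> [->|[->|[->|//]]]; [left | right; left | right; right].
Qed.

(** * Matrices that attain the three lists *)

Definition mx4 (R : realType) (rows : seq (seq R)) : 'M[R]_4 :=
  \matrix_(i, j) nth 0 (nth [::] rows i) j.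

(** The general element of [SL K4_minus_e] that is invariant under the exchange
    of 0 and 3, the two vertices that are not adjacent. *)
Definition sym_laplacian (R : realType) (a b c : R) : 'M[R]_4 :=
  mx4 [:: [:: a + b; - a; - b; 0];
          [:: - a; a + a + c; - c; - a];
          [:: - b; - c; b + b + c; - b];
          [:: 0; - a; - b; a + b]].

Ltac mx4_entries :=
  apply/matrixP; case=> [[|[|[|[|i]]]] Hi] //; case=> [[|[|[|[|j]]]] Hj] //;
  rewrite !mxE ?(mxE, big_ord_recl, big_ord0) /=.

Lemma SL_sym_laplacian (R : realType) (a b c : R) :
  0 < a -> 0 < b -> 0 < c -> SL K4_minus_e (sym_laplacian a b c).
Proof.
move=> a0 b0 c0; split.
- by mx4_entries.
- case=> [[|[|[|[|i]]]] Hi] //; case=> [[|[|[|[|j]]]] Hj] // _;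
  by rewrite !mxE /= oppr_lt0.
- by case=> [[|[|[|[|i]]]] Hi] //; case=> [[|[|[|[|j]]]] Hj] // _ _; rewrite !mxE.
- case=> [[|[|[|[|i]]]] Hi] //;
  rewrite big_mkcond /= !big_ord_recl big_ord0 /= !mxE /=; ring.
Qed.

Lemma unitmx_orthogonal_rows (F : fieldType) n (P : 'M[F]_n) (d : 'rV[F]_n) :
  P *m P^T = diag_mx d -> (forall i, d 0 i != 0) -> P \in unitmx.
Proof.
move=> PPt d0; rewrite unitmxE unitfE; apply/negP => /eqP detP.
have := congr1 (fun M => \det M) PPt; rewrite det_mulmx detP mul0r det_diag.
by move/esym/eqP; apply/negP/prodf_neq0 => i _.
Qed.

(** Eigenvalues are given by a sorted list of natural numbers, so that
    multiplicities and the order of the spectrum are found by computation. *)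
Lemma mult_list_of_eigenbasis (R : realType) n (A P : 'M[R]_n) (t : seq nat) :
    size t = n -> sorted leq t -> P \in unitmx ->
    P *m A = diag_mx (\row_i (nth 0%N t i)%:R) *m P ->
  is_ordered_mult_list A [seq count_mem k t | k <- undup t].
Proof.
move=> tn t_sorted P_unit PA.
pose tR : seq R := [seq k%:R | k <- t].
have cpA : char_poly A = \prod_(x <- tR) ('X - x%:P).
  rewrite (char_poly_diag P_unit PA) big_map (big_nth 0%N) big_mkord tn.
  by apply: eq_bigr => i _; rewrite mxE.
have natI : injective (fun k : nat => k%:R : R) by apply: mulrIn; exact: oner_neq0.
exists [seq k%:R | k <- undup t]; split.
- apply: (homo_sorted (e := ltn)) => [k l|]; first by rewrite ltr_nat.
  rewrite ltn_sorted_uniq_leq undup_uniq /=.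
  exact: (subseq_sorted leq_trans (undup_subseq t)).
- move=> x; rewrite eigenvalue_root_char cpA root_prod_XsubC.
  by apply/mapP/mapP => -[k kt ->]; exists k; rewrite ?mem_undup // -mem_undup.
- rewrite -map_comp; apply: eq_map => k /=.
  rewrite cpA mu_prod_XsubC count_map; apply: eq_count => l /=.
  by rewrite (inj_eq natI).
Qed.

(** The eigenvectors [rows] are taken orthogonal, with squared norms [e]: this
    shows that they form a basis without computing a determinant. *)
Lemma sym_laplacian_mult_list (R : realType) (a b c : R) (rows : seq (seq R))
    (t e : seq nat) :
    size t = 4 -> sorted leq t -> size e = 4 -> 0%N \notin e ->
    mx4 rows *m sym_laplacian a b c = diag_mx (\row_i (nth 0%N t i)%:R) *m mx4 rows ->
    mx4 rows *m (mx4 rows)^T = diag_mx (\row_i (nth 0%N e i)%:R) ->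
  is_ordered_mult_list (sym_laplacian a b c) [seq count_mem k t | k <- undup t].
Proof.
move=> t4 t_sorted e4 e0 PA PPt; apply: mult_list_of_eigenbasis PA => //.
apply: unitmx_orthogonal_rows PPt _ => i.
by rewrite mxE pnatr_eq0; apply: contraNneq e0 => <-; rewrite mem_nth // e4.
Qed.

Lemma mult_list_1111_attained (R : realType) :
  ordered_mult_lists R K4_minus_e [:: 1; 1; 1; 1]%N.
Proof.
exists (sym_laplacian 1 1 2); first by apply: SL_sym_laplacian; rewrite ?ltr0n ?ltr01.
apply: (@sym_laplacian_mult_list R 1 1 2
  [:: [:: 1; 1; 1; 1]; [:: 1; 0; 0; -1]; [:: 1; -1; -1; 1]; [:: 0; 1; -1; 0]]
  [:: 0; 2; 4; 6]%N [:: 4; 2; 4; 2]%N) => //.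
all: mx4_entries; ring.
Qed.

Lemma mult_list_112_attained (R : realType) :
  ordered_mult_lists R K4_minus_e [:: 1; 1; 2]%N.
Proof.
exists (sym_laplacian 1 1 1); first by apply: SL_sym_laplacian; rewrite ?ltr0n ?ltr01.
apply: (@sym_laplacian_mult_list R 1 1 1
  [:: [:: 1; 1; 1; 1]; [:: 1; 0; 0; -1]; [:: 1; -1; -1; 1]; [:: 0; 1; -1; 0]]
  [:: 0; 2; 4; 4]%N [:: 4; 2; 4; 2]%N) => //.
all: mx4_entries; ring.
Qed.

Lemma mult_list_121_attained (R : realType) :
  ordered_mult_lists R K4_minus_e [:: 1; 2; 1]%N.
Proof.
exists (sym_laplacian 1 3 1); first by apply: SL_sym_laplacian; rewrite ?ltr0n ?ltr01.
apply: (@sym_laplacian_mult_list R 1 3 1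
  [:: [:: 1; 1; 1; 1]; [:: 1; 0; 0; -1]; [:: 1; -3; 1; 1]; [:: 1; 0; -2; 1]]
  [:: 0; 4; 4; 10]%N [:: 4; 2; 12; 6]%N) => //.
all: mx4_entries; ring.
Qed.

End Auxiliary.

Theorem theorem3p8 (R : realType) :
  ordered_mult_lists R K4_minus_e =
    [set [:: 1; 1; 1; 1]%N; [:: 1; 1; 2]%N; [:: 1; 2; 1]%N].
Proof.
apply/seteqP; split=> m /=.
  move=> [A AG /(mult_list_K4_minus_e AG)[->|[->|->]]];
  by [left; left | left; right | right].
move=> [[->|->]|->].
- exact: mult_list_1111_attained.
- exact: mult_list_112_attained.
- exact: mult_list_121_attained.
Qed.
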